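(* Let $n\ge1$ and let ${\tt T}_n$ be the transitive tournament on $n$ vertices $1,\dots,n$ (edges $(i,j)$ for all $i<j$). Then \[\widetilde{\chi}(X({\tt T}_n))=\sum_{k=1}^{n}(-1)^{n-k-1}S(n,k),\] where $S(n,k)$ are the Stirling numbers of the second kind, and the sequence $\big(\widetilde{\chi}(X({\tt T}_n))\big)_n$ has exponential generating function $-e^{1-e^{-x}}$.
   Context: For a digraph ${\tt G}$, a multipath is a spanning subgraph each of whose connected components is a single vertex or a simple (directed, non-closed, vertex-disjoint) path; equivalently a set of edges with all in- and out-degrees at most $1$ and no oriented cycle. The multipath complex $X({\tt G})$ is the simplicial complex on vertex set $E({\tt G})$ whose simplices are the nonempty edge sets of multipaths. $\widetilde{\chi}$ denotes the reduced Euler characteristic (the empty complex has $\widetilde{\chi}=-1$). *)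

(* Defs.v *)
From mathcomp Require Import all_boot all_order all_algebra.
From mathcomp Require Import all_classical all_reals all_analysis.
Set Implicit Arguments.
Unset Strict Implicit.
Unset Printing Implicit Defensive.
Import Order.TTheory GRing.Theory Num.Theory.
Import numFieldNormedType.Exports.
Local Open Scope classical_set_scope.
Local Open Scope ring_scope.

Section Multipaths.
Variable V : finType.
Implicit Types (g : rel V) (M : {set V * V}) (C : {set V}).

Definition edges g : {set V * V} := [set e | g e.1 e.2]%SET.

(* A spanning subgraph of g is identified with its edge set M; its connected
   components are those of the underlying undirected graph. *)
Definition adjacent M : rel V :=
  fun x y => ((x, y) \in M) || ((y, x) \in M).

Definition component M (x : V) : {set V} :=
  [set y | connect (adjacent M) x y]%SET.

(* The subgraph of M induced on C is a simple directed path: p lists the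
   vertices of C without repetition, and the induced edges are exactly the
   pairs of consecutive vertices of p.  When C is a singleton this says that
   the subgraph is an isolated vertex. *)
Definition is_simple_path M C : bool :=
  [exists p : #|C|.-tuple V,
    [&& uniq p, [set x in p]%SET == C &
        [set e in M | (e.1 \in C) && (e.2 \in C)]%SET
          == [set e in zip p (behead p)]%SET]].

Definition is_multipath g M : bool :=
  (M \subset edges g) && [forall x, is_simple_path M (component M x)].

Definition multipath_complex g : {set {set V * V}} :=
  [set M | (M != finset.set0) && is_multipath g M]%SET.

End Multipaths.

(* K is the set of nonempty simplices of the complex; a simplex s has
   dimension #|s| - 1, and the final - 1 accounts for the empty simplex. *)
Definition reduced_euler (W : finType) (K : {set {set W}}) : int :=
  (\sum_(s in K) (-1) ^+ #|s|.-1) - 1.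

Definition transitive_tournament (n : nat) : rel 'I_n :=
  fun i j => (i < j)%N.

(* Number of partitions of an n-element set into k nonempty blocks. *)
Definition stirling2 (n k : nat) : nat :=
  #|[set P : {set {set 'I_n}} | finset.partition P [set: 'I_n]%SET & #|P| == k]%SET|.

(* The exponential generating series of a converges to F on the whole line;
   since a power series is determined by its sum near 0, this contains the
   identity of formal power series. *)
Definition has_egf (R : realType) (a : nat -> int) (F : R -> R) : Prop :=
  forall x : R,
    series (fun n => (a n)%:~R / n`!%:R * x ^+ n) @ \oo --> F x.

(* Main.v *)
(* A multipath in T_n is determined by the vertex sets of its components: each
   component is a path along increasing vertices, so it must list its vertex
   set in increasing order.  Multipaths with m edges thus correspond to
   partitions of [n] into n - m blocks, which gives the Stirling sum.

   Up to signs the n-th value is d_n, the sum of (-1)^(number of blocks) over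
   partitions of [n].  Removing the block of a fixed element gives
   d_(n+1) = - sum_j C(n, j) d_j.  By induction d_n / n! decays faster than any
   geometric sequence, so G(x) = sum_n d_n x^n / n! is entire, and the recursion
   says G' = - e^x G.  Hence G(x) exp(e^x) is constant and G(x) = exp(1 - e^x);
   the generating function of the theorem is - G(-x). *)
Require Import Defs.
From mathcomp Require Import all_boot all_order all_algebra.
Import Order.TTheory GRing.Theory Num.Theory.
Local Open Scope ring_scope.
Set Implicit Arguments.
Unset Strict Implicit.

(** * Signed count of set partitions and its recursion *)

Section SignedPartitions.
Variable T : finType.
Implicit Types (A B : {set T}) (P Q : {set {set T}}).

Definition signed_partitions A : int :=
  \sum_(P : {set {set T}} | partition P A) (-1) ^+ #|P|.

Lemma signed_partitions0 : signed_partitions set0 = 1.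
Proof.
rewrite /signed_partitions (big_pred1 set0) ?cards0 // => P.
exact: partition_set0.
Qed.

(* [B] is the set of elements that lie outside the block of [x]. *)
Lemma signed_partitionsU1 x A : x \notin A ->
  signed_partitions (x |: A) = - \sum_(B in powerset A) signed_partitions B.
Proof.
move=> xA; rewrite /signed_partitions.
rewrite (partition_big (fun P => A :\: pblock P x) (mem (powerset A))) /=;
  last by move=> P _; rewrite inE subsetDl.
rewrite -sumrN; apply: eq_bigr => B; rewrite inE => sBA.
pose C := x |: (A :\: B).
have CB : [disjoint C & B].
  rewrite -setI_eq0 setIUl setU_eq0; apply/andP; split.
    by rewrite setI_eq0 disjoints1; apply: contra xA; apply: (subsetP sBA).
  by rewrite setDE -setIA [~: B :&: B]setIC setICr setI0.
have CUB : C :|: B = x |: A.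
  by rewrite /C -setUA; congr setU; rewrite setUC -{1}(setIidPr sBA) setID.
have C0 : C != set0 by apply/set0Pn; exists x; rewrite setU11.
have CQ Q : partition Q B -> C \notin Q.
  move=> PQ; apply/negP => CinQ; case/negP: C0.
  rewrite -subset0 -(disjoint_setI0 CB) subsetI subxx.
  exact: partitionS PQ CinQ.
(* Inserting the block [C] is a bijection from the partitions of [B] onto the partitions of [x |: A]
   in which [C] is the block of [x]; the extra block flips the sign. *)
rewrite (reindex_onto (fun Q => C |: Q) (fun P => P :\ C)); last first.
  move=> P /andP[PP /eqP PB]; rewrite setD1K //.
  have xP : x \in cover P by rewrite (cover_partition PP) setU11.
  suff -> : C = pblock P x by apply: pblock_mem.
  have := partitionS PP (pblock_mem xP); have := xP; rewrite -mem_pblock /C -PB.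
  move: (pblock P x) => D xD DA; apply/setP => y; rewrite !inE.
  have := subsetP DA y; rewrite !inE.
  by case: eqVneq => [-> _|_ /=]; rewrite ?xD //; case: (y \in D); case: (y \in A) => // ->.
rewrite -sumrN; apply: eq_big => [Q|Q /andP[/andP[PQ _] /eqP CQ']]; last first.
  by rewrite cardsU1 -{1}CQ' setD11 exprS mulN1r.
apply/idP/idP => [/andP[/andP[PQ /eqP PB] /eqP CQ']|PQ].
  have CnQ : C \notin Q by rewrite -CQ' setD11.
  have := partitionD1 PQ (setU11 _ _).
  rewrite CQ' -CUB; congr partition.
  by rewrite setDUl setDv set0U; apply/setDidPl; rewrite disjoint_sym.
have PCQ : partition (C |: Q) (x |: A) by rewrite -CUB partitionU1.
have -> : pblock (C |: Q) x = C.
  by apply: def_pblock (partition_trivIset PCQ) _ _; rewrite setU11.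
rewrite PCQ setU1K ?CQ // eqxx andbT /= /C setDUr setDDr setDv set0U.
rewrite (setIidPr sBA) setIC; apply/eqP/setIidPl/subsetP => y yB.
by rewrite !inE (subsetP sBA) // andbT; apply: contraNneq xA => <-; apply: (subsetP sBA).
Qed.

Lemma sum_powerset_card (f : nat -> int) A :
  \sum_(B in powerset A) f #|B| = \sum_(j < #|A|.+1) f j *+ 'C(#|A|, j).
Proof.
(* [inord] never falls back to its default value here, since a subset of [A] has at most [#|A|]
   elements. *)
rewrite (partition_big (fun B : {set T} => inord #|B| : 'I_#|A|.+1) predT) //=.
apply: eq_bigr => j _; rewrite -cards_draws -sumr_const.
apply: eq_big => [B|B /andP[]]; rewrite !inE.
  case: (boolP (B \subset A)) => //= sBA.
  by rewrite -val_eqE /= inordK // ltnS subset_leq_card.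
by move=> sBA /eqP <-; rewrite inordK // ltnS subset_leq_card.
Qed.
End SignedPartitions.

(* The values of the Touchard polynomials at [-1] (complementary Bell numbers). *)
Definition complementary_bell n : int := signed_partitions [set: 'I_n].

(** Once smaller sets are known, the recursion involves only cardinalities. The induction ranges
    over all finite types because [A] is compared with the full set of ['I_#|A|]. *)
Lemma signed_partitions_card (T : finType) (A : {set T}) :
  signed_partitions A = complementary_bell #|A|.
Proof.
have [n] := ubnP #|A|; elim: n T A => // n IHn T A; rewrite ltnS => leAn.
have [->|/set0Pn[x xA]] := eqVneq A set0.
  rewrite cards0 /complementary_bell signed_partitions0.
  by rewrite (_ : [set: 'I_0] = set0) ?signed_partitions0 //; apply/setP => -[].
have rec (U : finType) (y : U) (B : {set U}) : y \in B -> (#|B| <= n)%N ->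
    signed_partitions B =
    - \sum_(j < #|B|) complementary_bell j *+ 'C(#|B|.-1, j).
  move=> yB leBn; rewrite -(setD1K yB) signed_partitionsU1 ?setD11 //.
  rewrite (setD1K yB) (cardsD1 y B) yB add1n /=.
  rewrite -sum_powerset_card; congr (- _); apply: eq_bigr => D.
  rewrite inE => sDB; apply: IHn; apply: leq_trans leBn.
  by rewrite (cardsD1 y B) yB ltnS subset_leq_card.
have cA : #|A| = #|A :\ x|.+1 by rewrite (cardsD1 x A) xA.
rewrite (rec _ _ _ xA leAn); move: leAn; rewrite cA => leAn.
by rewrite [RHS](rec _ ord0) ?inE // cardsT card_ord.
Qed.

Lemma complementary_bell0 : complementary_bell 0 = 1.
Proof. by rewrite -(cards0 void) -signed_partitions_card signed_partitions0. Qed.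

Lemma complementary_bellS n :
  complementary_bell n.+1 = - \sum_(j < n.+1) complementary_bell j *+ 'C(n, j).
Proof.
have /setD1K E : ord0 \in [set: 'I_n.+1] by rewrite inE.
rewrite {1}/complementary_bell -E signed_partitionsU1 ?setD11 //.
have cE : #|[set: 'I_n.+1] :\ ord0| = n.
  by apply/succn_inj; rewrite -[RHS]card_ord -cardsT (cardsD1 ord0 [set: _]) inE.
have := sum_powerset_card complementary_bell ([set: 'I_n.+1] :\ ord0).
rewrite cE => <-; congr (- _).
by apply: eq_bigr => B _; rewrite signed_partitions_card.
Qed.

(** * Connected components of an edge set *)

Lemma sorted_zip_behead (T : Type) (e : rel T) (s : seq T) :
  sorted e s = all (fun z => e z.1 z.2) (zip s (behead s)).
Proof. by case: s => //= x s; elim: s x => //= y s IHs x; rewrite IHs. Qed.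

Lemma mem_zip (S T : eqType) (s : seq S) (t : seq T) x y :
  (x, y) \in zip s t -> x \in s /\ y \in t.
Proof.
elim: s t => [|a s IHs] [|b t] //=; rewrite !inE.
by case/predU1P => [[-> ->]|/IHs[-> ->]]; rewrite ?eqxx ?orbT.
Qed.

Section Components.
Variables (V : finType) (M : {set V * V}).

Definition components : {set {set V}} := [set component M x | x : V].

Lemma connect_adjacent_sym : connect_sym (adjacent M).
Proof. by apply: sym_connect_sym => x y; rewrite /adjacent orbC. Qed.

Lemma components_partition : partition components [set: V].
Proof.
suff <- : equivalence_partition (connect (adjacent M)) setT = components.
  apply: equivalence_partitionP => x y z _ _ _; split; first exact: connect0.
  by move=> cxy; rewrite (same_connect connect_adjacent_sym cxy).
rewrite /equivalence_partition /components.
apply/setP => C; apply/imsetP/imsetP => -[x _ ->]; exists x => //;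
  by apply/setP => y; rewrite !inE.
Qed.

Lemma sub_zip_behead_connect (s : seq V) x y :
  {subset zip s (behead s) <= M} -> x \in s -> y \in s ->
  connect (adjacent M) x y.
Proof.
case: s => // a s sM xs ys.
have pth : path (adjacent M) a s.
  rewrite -[path _ _ _]/(sorted _ (a :: s)) sorted_zip_behead.
  by apply/allP => -[u v] /sM uvM; rewrite /adjacent uvM.
apply: (@connect_trans _ _ a); last exact: path_connect pth _ ys.
by rewrite connect_adjacent_sym; exact: path_connect pth _ xs.
Qed.

End Components.

(** * Bijection between multipaths of the tournament and partitions *)

Section TournamentMultipaths.
Variable n : nat.
Implicit Types (C : {set 'I_n}) (P : {set {set 'I_n}}) (M : {set 'I_n * 'I_n}).
Local Notation T_n := (@transitive_tournament n).

(** Since [enum C] is increasing, these are the edges of the only directed path of the tournament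
    with vertex set [C]. *)
Definition consecutive_pairs C : {set 'I_n * 'I_n} :=
  [set e in zip (enum C) (behead (enum C))].

Definition path_edges P := \bigcup_(C in P) consecutive_pairs C.

Lemma consecutive_pairs_sub C e :
  e \in consecutive_pairs C -> (e.1 \in C) && (e.2 \in C).
Proof.
case: e => x y; rewrite inE => /mem_zip[]; rewrite mem_enum => -> /mem_behead.
by rewrite mem_enum.
Qed.

Lemma card_consecutive_pairs C : #|consecutive_pairs C| = #|C|.-1.
Proof.
rewrite cardsE (card_uniqP _) ?zip_uniql ?enum_uniq //.
by rewrite size_zip size_behead -cardE (minn_idPr (leq_pred _)).
Qed.

Lemma sorted_enum_set C : sorted T_n (enum C).
Proof.
have: sorted ltn (map val (enum 'I_n)) by rewrite val_enum_ord iota_ltn_sorted.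
rewrite sorted_map => srt; rewrite /enum_mem -enumT; apply: sorted_filter srt.
by move=> y x z; exact: ltn_trans.
Qed.

Lemma consecutive_pairs_ltn C e : e \in consecutive_pairs C -> T_n e.1 e.2.
Proof.
by rewrite inE; move: (sorted_enum_set C); rewrite sorted_zip_behead => /allP/[apply].
Qed.

(** The list [p] witnessing a simple path is strictly increasing, because its consecutive pairs are
    edges of the tournament. A strictly sorted list is determined by its elements, so [p] is the
    enumeration of the component. *)
Lemma multipath_componentE M x : is_multipath T_n M ->
  [set e in M | (e.1 \in component M x) && (e.2 \in component M x)]
    = consecutive_pairs (component M x).
Proof.
case/andP => /subsetP ME /forallP/(_ x)/existsP[p /and3P[_ /eqP pC /eqP pE]].
rewrite /consecutive_pairs pE.
suff -> : enum (component M x) = p by [].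
apply: (@irr_sorted_eq _ T_n) => [y z t||||y].
- exact: ltn_trans.
- by move=> y; rewrite /transitive_tournament ltnn.
- exact: sorted_enum_set.
- rewrite sorted_zip_behead; apply/allP => e ep.
  have : e \in [set e in zip p (behead p)] by rewrite inE.
  by rewrite -pE inE => /andP[/ME]; rewrite inE.
- by rewrite mem_enum; move/setP/(_ y): pC; rewrite inE.
Qed.

(** One half of the bijection: each edge has both ends in the component of its source, where
    [multipath_componentE] identifies the edges. *)
Lemma path_edges_components M :
  is_multipath T_n M -> path_edges (components M) = M.
Proof.
move=> mM; apply/setP => e; apply/bigcupP/idP => [[_ /imsetP[x _ ->]]|eM].
  by rewrite -multipath_componentE // inE => /andP[].
exists (component M e.1); first exact: imset_f.
rewrite -multipath_componentE // !inE eM connect0 /= connect1 // /adjacent.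
by rewrite -surjective_pairing eM.
Qed.

Section PathEdges.
Variable P : {set {set 'I_n}}.
Hypothesis PT : partition P [set: 'I_n].

Lemma mem_pblockT x : x \in pblock P x.
Proof. by rewrite mem_pblock (cover_partition PT) inE. Qed.

(** Blocks are disjoint, so an edge starting in [C] can only come from the path through [C]. *)
Lemma path_edgesE C e : C \in P ->
  (e \in path_edges P) && (e.1 \in C) = (e \in consecutive_pairs C).
Proof.
move=> CP; apply/andP/idP => [[/bigcupP[D DP eD] eC]|eC].
  have /andP[e1D _] := consecutive_pairs_sub eD.
  have tP := partition_trivIset PT.
  by rewrite -(def_pblock tP CP eC) (def_pblock tP DP e1D).
have /andP[e1C _] := consecutive_pairs_sub eC.
by split => //; apply/bigcupP; exists C.
Qed.

(** Every edge stays inside one block, so blocks are closed under adjacency and contain the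
    components of their points; conversely the path through a block connects it. *)
Lemma component_path_edges x : component (path_edges P) x = pblock P x.
Proof.
have tP := partition_trivIset PT.
have xP : pblock P x \in P by rewrite pblock_mem ?(cover_partition PT) ?inE.
apply/setP => y; rewrite inE; apply/idP/idP => [cxy|yx].
  suff cl : closed (adjacent (path_edges P)) (pblock P x).
    by rewrite -(closed_connect cl cxy) mem_pblockT.
  have adj z t : (z, t) \in path_edges P -> (z \in pblock P x) = (t \in pblock P x).
    case/bigcupP => C CP /consecutive_pairs_sub /= /andP[zC tC].
    apply/idP/idP => /(def_pblock tP xP) <-.
      by rewrite (def_pblock tP CP zC).
    by rewrite (def_pblock tP CP tC).
  by move=> z t /orP[/adj|/adj].
apply: (@sub_zip_behead_connect _ _ (enum (pblock P x))) => [e e_zip||].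
- by apply/bigcupP; exists (pblock P x); rewrite // inE.
- by rewrite mem_enum mem_pblockT.
- by rewrite mem_enum.
Qed.

Lemma components_path_edges : components (path_edges P) = P.
Proof.
apply/setP => C; apply/imsetP/idP => [[x _ ->]|CP].
  by rewrite component_path_edges pblock_mem ?(cover_partition PT) ?inE.
have /set0Pn[x xC] := partition_neq0 PT CP.
exists x => //.
by rewrite component_path_edges (def_pblock (partition_trivIset PT) CP xC).
Qed.

Lemma path_edges_multipath : is_multipath T_n (path_edges P).
Proof.
apply/andP; split.
  by apply/bigcupsP => C _; apply/subsetP => e /consecutive_pairs_ltn; rewrite inE.
apply/forallP => x; rewrite component_path_edges; set C := pblock P x.
have CP : C \in P by rewrite pblock_mem ?(cover_partition PT) ?inE.
have sC : size (enum C) == #|C| by rewrite -cardE.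
apply/existsP; exists (Tuple sC); apply/and3P; split => /=.
- exact: enum_uniq.
- by apply/eqP/setP => y; rewrite inE mem_enum.
apply/eqP/setP => e; rewrite -/(consecutive_pairs C) inE andbA path_edgesE //.
by apply: andb_idr => /consecutive_pairs_sub/andP[].
Qed.

(** Sorting edges by the block of their source, a block [C] accounts for [#|C|.-1] edges and for
    itself, that is for [#|C|] in total. *)
Lemma card_path_edges : (#|path_edges P| + #|P| = n)%N.
Proof.
have tP := partition_trivIset PT.
rewrite -[RHS]card_ord -cardsT (card_partition PT) -!sum1_card.
rewrite (partition_big (fun e => pblock P e.1) (mem P)) /=; last first.
  by move=> e _; rewrite pblock_mem ?(cover_partition PT) ?inE.
rewrite -big_split /=; apply: eq_bigr => C CP.
have -> : \sum_(e in path_edges P | pblock P e.1 == C) 1 = #|C|.-1 :> nat.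
  rewrite -card_consecutive_pairs -sum1_card; apply: eq_bigl => e.
  rewrite -path_edgesE //; congr (_ && _); apply/eqP/idP => [<-|].
    exact: mem_pblockT.
  exact: def_pblock.
by rewrite addn1 prednK // card_gt0 (partition_neq0 PT).
Qed.

Lemma partition_ord_leq : (#|P| <= n)%N.
Proof. by have := leq_addl #|path_edges P| #|P|; rewrite card_path_edges. Qed.

End PathEdges.

Lemma multipath_set0 : is_multipath T_n set0.
Proof.
(* The partition into singletons yields the multipath without edges. *)
have PT := preim_partitionP id [set: 'I_n].
suff <- : path_edges (preim_partition id [set: 'I_n]) = set0.
  exact: path_edges_multipath.
apply: big1 => _ /imsetP[x _ ->]; apply/eqP; rewrite -cards_eq0.
rewrite card_consecutive_pairs (_ : [set _ in _ | _] = [set x]) ?cards1 //.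
by apply/setP => y; rewrite !inE eq_sym.
Qed.

Lemma sum_multipaths (R : zmodType) (F : nat -> R) :
  \sum_(M | is_multipath T_n M) F #|M| =
  \sum_(P : {set {set 'I_n}} | partition P [set: 'I_n]) F (n - #|P|)%N.
Proof.
rewrite (reindex_onto path_edges (@components 'I_n)) /=; last first.
  exact: path_edges_components.
apply: eq_big => [P|P /andP[_ /eqP <-]].
  (* A [P] fixed by the round trip is a set of components, hence a partition. *)
  apply/andP/idP => [[_ /eqP <-]|PT]; first exact: components_partition.
  by rewrite path_edges_multipath // components_path_edges.
set Q := components _; have QT : partition Q setT by exact: components_partition.
by congr F; apply: (canRL (addnK #|Q|)); exact: card_path_edges.
Qed.

(** The empty multipath supplies the final [- 1] of [reduced_euler]; for nonempty [M], passing from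
    [#|M|.-1] to [#|M|] gives the global sign. *)
Lemma reduced_euler_tournament :
  reduced_euler (multipath_complex T_n) =
  - \sum_(P : {set {set 'I_n}} | partition P [set: 'I_n]) (-1) ^+ (n - #|P|).
Proof.
rewrite -(sum_multipaths (fun m => (-1) ^+ m)) (bigD1 set0) ?multipath_set0 //=.
rewrite cards0 expr0 opprD addrC /reduced_euler; congr (_ + _).
rewrite -sumrN; apply: eq_big => [M|M]; rewrite inE; first by rewrite andbC.
case/andP => M0 _; rewrite -card_gt0 in M0; case: #|M| M0 => // m _.
by rewrite exprS mulN1r opprK.
Qed.

Lemma reduced_euler_tournament_bell :
  reduced_euler (multipath_complex T_n) = - ((-1) ^+ n * complementary_bell n).
Proof.
rewrite reduced_euler_tournament /complementary_bell /signed_partitions mulr_sumr.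
congr (- _); apply: eq_bigr => P /partition_ord_leq leP.
(* As [#|P| <= n], the truncated difference [n - #|P|] is exact and has the parity of [n + #|P|]. *)
by rewrite -[X in _ = (-1) ^+ X * _](subnK leP) exprD -mulrA -expr2 sqrr_sign mulr1.
Qed.

Lemma reduced_euler_tournament_stirling : (0 < n)%N ->
  reduced_euler (multipath_complex T_n) =
  \sum_(1 <= k < n.+1) (-1 : int) ^ (n%:Z - k%:Z - 1) * (stirling2 n k)%:Z.
Proof.
move=> n_gt0; rewrite reduced_euler_tournament.
rewrite (partition_big (fun P : {set {set 'I_n}} => inord #|P| : 'I_n.+1) predT) //=.
have cP (P : {set {set 'I_n}}) : partition P setT -> (#|P| < n.+1)%N.
  exact: partition_ord_leq.
have E (k : 'I_n.+1) : \sum_(P : {set {set 'I_n}} | partition P setT && (inord #|P| == k))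
     (-1) ^+ (n - #|P|) = (-1) ^+ (n - k) * (stirling2 n k)%:Z.
  rewrite -[(stirling2 n k)%:Z]natz mulr_natr -sumr_const; apply: eq_big => [P|P /andP[PT /eqP <-]].
    rewrite inE; apply: andb_id2l => PT.
    by rewrite -val_eqE /= inordK ?cP.
  by rewrite inordK ?cP.
rewrite (eq_bigr _ (fun k _ => E k)) big_ord_recl.
(* The term of index 0 vanishes: a partition without blocks has no path edges, which would force
   [n = 0]. *)
have -> : stirling2 n (ord0 : 'I_n.+1) = 0%N.
  apply/eqP; rewrite cards_eq0; apply/eqP/setP => P; rewrite !inE.
  apply/negP => /andP[PT /eqP P0]; have := card_path_edges PT.
  by rewrite P0 (cards0_eq P0) /path_edges big_set0 cards0 => n0; rewrite -n0 in n_gt0.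
rewrite mulr0 add0r big_add1 big_mkord -sumrN; apply: eq_bigr => k _.
rewrite /= -mulNr; congr (_ * _).
(* The integer exponent is -1 for the last index, so the factor [(-1) ^ (- 1) = -1] is split off
   before passing to natural exponents. *)
rewrite subzn // exprzDr ?unitrN1 // -exprnP mulrC.
by rewrite (_ : (-1) ^ (- 1) = -1 :> int) // mulN1r.
Qed.
End TournamentMultipaths.

From mathcomp Require Import all_classical all_reals all_analysis.
From mathcomp Require Import ring lra.
Import numFieldNormedType.Exports.

(** * Power series with infinite radius of convergence *)

Section PowerSeries.
Local Open Scope classical_set_scope.
Local Open Scope ring_scope.
Variable R : realType.
Implicit Types (a b : nat -> R) (x : R).

(** Equivalent to an infinite radius of convergence, but phrased as explicit bounds that suit
    induction and products. *)
Definition entire_coefs a : Prop :=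
  forall rho : R, 0 < rho -> exists C, forall n, `|a n| <= C * rho ^+ n.

Lemma entire_coefs_scale a x : entire_coefs a ->
  entire_coefs (fun n => a n * x ^+ n).
Proof.
move=> ea rho rho_gt0.
(* Adding 1 keeps the divisor nonzero when [x = 0]. *)
have x1_gt0 : 0 < `|x| + 1 by rewrite ltr_wpDl.
have [C aC] := ea _ (divr_gt0 rho_gt0 x1_gt0).
exists C => n; rewrite normrM normrX.
have -> : C * rho ^+ n = C * (rho / (`|x| + 1)) ^+ n * (`|x| + 1) ^+ n.
  by rewrite -mulrA -exprMn divfK // gt_eqF.
by rewrite ler_pM // lerXn2r ?nnegrE ?lerDl // ltW.
Qed.

Lemma entire_coefs_ge0 a rho C : (forall n, `|a n| <= C * rho ^+ n) -> 0 <= C.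
Proof. by move=> /(_ 0%N); rewrite expr0 mulr1; apply: le_trans. Qed.

Lemma entire_cvg a x : entire_coefs a -> cvgn (pseries a x).
Proof.
move=> /(entire_coefs_scale x)/(_ 2^-1)[//|C aC].
apply: normed_cvg; apply: (@series_le_cvg _ _ (geometric C 2^-1)) => //= [n|].
  by rewrite /geometric /= mulr_ge0 ?exprn_ge0 // (entire_coefs_ge0 aC).
by apply: is_cvg_geometric_series; rewrite ger0_norm // invf_lt1 // ltr1n.
Qed.

Lemma natr_le_exp2 n : n%:R <= 2 ^+ n :> R.
Proof. by rewrite -natrX ler_nat ltnW // ltn_expl. Qed.

Lemma entire_pseries_diffs a : entire_coefs a -> entire_coefs (pseries_diffs a).
Proof.
(* Halving the ratio gains [2 ^+ n.+1], which absorbs the factor [n.+1] of the formal derivative. *)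
move=> ea rho rho_gt0; have [|C aC] := ea (rho / 2); first by rewrite divr_gt0.
exists (C * rho) => n; rewrite /pseries_diffs normrM normr_nat.
apply: le_trans (ler_pM _ _ (natr_le_exp2 n.+1) (aC n.+1)) _ => //.
by rewrite mulrCA -exprMn [2 * _]mulrC divfK // exprS mulrA.
Qed.

(** Both sides run over the pairs with [i + j < n], first by antidiagonals and then by rows. *)
Lemma triangle_sum (f : nat -> nat -> R) n :
  \sum_(0 <= k < n) \sum_(i < k.+1) f i (k - i)%N =
  \sum_(i < n) \sum_(j < n - i) f i j.
Proof.
elim: n => [|n IHn]; first by rewrite big_geq // big_ord0.
rewrite big_nat_recr //= IHn [RHS]big_ord_recr /= [in LHS]big_ord_recr /=.
rewrite subSn // subnn big_ord1 addrA; congr (_ + _).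
rewrite -big_split /=; apply: eq_bigr => i _.
by rewrite subSn ?(ltnW (ltn_ord i)) // big_ord_recr.
Qed.

(** The partial sums of the Cauchy product cover the triangle [i + j < n], and the products of
    partial sums cover the square. The difference has at most [n ^ 2 <= 4 ^ n] terms, each bounded
    by [C * D * 8^-1 ^+ n], hence is at most [C * D * 2^-1 ^+ n]; this dictates the ratio 1/8. *)
Lemma cvg_cauchy_product a b x : entire_coefs a -> entire_coefs b ->
  pseries (fun n => \sum_(i < n.+1) a i * b (n - i)%N) x @ \oo -->
  limn (pseries a x) * limn (pseries b x).
Proof.
move=> ea eb; pose a' n := a n * x ^+ n; pose b' n := b n * x ^+ n.
have [//|C aC] := @entire_coefs_scale a x ea 8^-1.
have [//|D bD] := @entire_coefs_scale b x eb 8^-1.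
have C_ge0 := entire_coefs_ge0 aC; have D_ge0 := entire_coefs_ge0 bD.
have AB := cvgM (entire_cvg (x := x) ea) (entire_cvg (x := x) eb).
apply: (cvg_sub0 _ (AB _)).
apply: norm_cvg0; apply: (@squeeze_cvgr _ _ _ _ (cst 0) (geometric (C * D) 2^-1)).
- apply: nearW => n; rewrite normr_ge0 /= -[X in `|X|]/(_ n - _ n) distrC.
  have -> : pseries (fun k => \sum_(i < k.+1) a i * b (k - i)%N) x n =
      \sum_(i < n) \sum_(j < n - i) a' i * b' j.
    rewrite -(triangle_sum (fun i j => a' i * b' j)) /pseries /series /=.
    apply: eq_bigr => k _; rewrite mulr_suml; apply: eq_bigr => i _.
    by rewrite /a' /b' mulrACA -exprD subnKC // -ltnS.
  have -> : (pseries a x \* pseries b x) n = \sum_(i < n) \sum_(j < n) a' i * b' j.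
    by rewrite /pseries /series /= !big_mkord big_distrlr.
  rewrite -sumrB; apply: le_trans (ler_norm_sum _ _ _) _.
  have tail (i : 'I_n) : `|\sum_(j < n) a' i * b' j - \sum_(j < n - i) a' i * b' j|
      <= n%:R * (C * D * 8^-1 ^+ n).
    rewrite -!(big_mkord xpredT (fun j => a' i * b' j)).
    rewrite [X in X - _](@big_cat_nat _ _ _ (n - i)) ?leq_subr //= addrAC subrr add0r.
    apply: le_trans (ler_norm_sum _ _ _) _.
    apply: (@le_trans _ _ (\sum_(n - i <= j < n) C * D * 8^-1 ^+ n)).
      apply: ler_sum_nat => j /andP[nij _]; rewrite normrM.
      apply: le_trans (ler_pM _ _ (aC i) (bD j)) _ => //.
      rewrite mulrACA -exprD ler_wpM2l ?mulr_ge0 // ler_wiXn2l ?invr_ge0 //.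
        by rewrite invf_le1 // ler1n.
      by rewrite -leq_subLR.
    rewrite sumr_const_nat subKn ?(ltnW (ltn_ord i)) // -[leLHS]mulr_natl.
    by rewrite ler_wpM2r ?ler_nat ?(ltnW (ltn_ord i)) // !mulr_ge0 ?exprn_ge0 ?invr_ge0.
  apply: le_trans (ler_sum _ (fun i _ => tail i)) _.
  rewrite sumr_const card_ord -[leLHS]mulr_natl.
  have -> : C * D * 2^-1 ^+ n = 2 ^+ n * (2 ^+ n * (C * D * 8^-1 ^+ n)) :> R.
    rewrite (_ : 2^-1 = 2 * (2 * 8^-1)); last by lra.
    by rewrite !exprMn mulrCA [X in _ * X = _]mulrCA.
  by rewrite !ler_pM ?natr_le_exp2 ?mulr_ge0 ?exprn_ge0 ?invr_ge0.
- exact: cvg_cst.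
- by apply: cvg_geometric; rewrite ger0_norm // invf_lt1 // ltr1n.
Qed.

Lemma is_derive_entire a x : entire_coefs a ->
  is_derive x (1 : R) (fun y => limn (pseries a y))
    (limn (pseries (pseries_diffs a) x)).
Proof.
move=> ea; have ea' := entire_pseries_diffs ea.
(* Termwise differentiation at [x] uses convergence of the series and of its first two formal
   derivatives at a point farther from 0. *)
apply: (@pseries_snd_diffs _ _ (`|x| + 1)); try exact: entire_cvg.
  exact/entire_cvg/entire_pseries_diffs.
by rewrite [ltRHS]ger0_norm ?ltrDl // addr_ge0.
Qed.

Lemma limn_pseries0 a : limn (pseries a 0) = a 0%N.
Proof.
apply: lim_near_cst => //; near=> n.
rewrite /pseries /series /= -[n]prednK; last by near: n; exact: nbhs_infty_gt.
rewrite big_nat_recl //= expr0 mulr1 big1 ?addr0 // => i _.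
by rewrite expr0n mulr0.
Unshelve. all: by end_near. Qed.

Lemma exp_partial_sum_le x n : 0 <= x ->
  \sum_(i < n) x ^+ i / i`!%:R <= expR x.
Proof.
move=> x_ge0; rewrite -(big_mkord xpredT (fun i => x ^+ i / i`!%:R)).
apply: (@nondecreasing_cvgn_le _ (series (exp_coeff x)) _ _ n).
  by apply: nondecreasing_series => i _ _; exact: exp_coeff_ge0.
exact: is_cvg_series_exp_coeff.
Qed.

(** [rho^-1 ^+ n / n!] is one term of the nonnegative series of [expR rho^-1], which therefore
    serves as the constant. *)
Lemma entire_inv_fact : entire_coefs (fun n => n`!%:R^-1).
Proof.
move=> rho rho_gt0; exists (expR rho^-1) => n.
have rn_gt0 : 0 < rho ^+ n by rewrite exprn_gt0.
rewrite ger0_norm // -ler_pdivrMr // mulrC -exprVn.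
apply: le_trans (exp_partial_sum_le n.+1 _); last by rewrite invr_ge0 ltW.
rewrite big_ord_recr /= lerDr sumr_ge0 // => i _.
by rewrite mulr_ge0 // exprn_ge0 // invr_ge0 ltW.
Qed.

(** * Generating function of the complementary Bell numbers *)

Definition bell_coef n : R := (complementary_bell n)%:~R / n`!%:R.

(** The recursion divided by [n!]: the binomial sum becomes the Cauchy product with the exponential
    series. *)
Lemma bell_coefS n :
  pseries_diffs bell_coef n = - \sum_(j < n.+1) bell_coef j * (n - j)`!%:R^-1.
Proof.
rewrite /pseries_diffs /bell_coef complementary_bellS factS natrM invfM.
rewrite mulrCA mulVKf // rmorphN rmorph_sum mulNr mulr_suml; congr (- _).
apply: eq_bigr => j _; rewrite rmorphMn -[LHS]/(_ *+ _ * _) -mulr_natr.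
rewrite -!mulrA; congr (_ * _).
have jn : (j <= n)%N by rewrite -ltnS.
rewrite -(bin_fact jn) !natrM !invfM mulVKf //.
by rewrite pnatr_eq0 -lt0n bin_gt0.
Qed.

Lemma entire_bell_coef : entire_coefs bell_coef.
Proof.
(* Bounding the terms of [bell_coefS] by induction gives [n.+1%:R * |bell_coef n.+1| <= C * rho ^+ n
   * expR rho^-1], and the last factor is [K * rho]. The bound thus passes to [n.+1] as soon as
   [K <= n.+1], which holds beyond [N]. *)
move=> rho rho_gt0; pose K := expR rho^-1 / rho.
have K_gt0 : 0 < K by rewrite divr_gt0 // expR_gt0.
have KN := archi_boundP (ltW K_gt0); set N := Num.bound K in KN.
(* Each summand enforces the bound at its own index, so [C] settles all indices up to [N]. *)
pose C := \sum_(j < N.+1) `|bell_coef j| / rho ^+ j.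
have rho_ge0 n : 0 <= rho ^+ n by rewrite exprn_ge0 // ltW.
have C_ge0 : 0 <= C by apply: sumr_ge0 => j _; rewrite divr_ge0.
exists C => n; have [m] := ubnP n; elim: m n => // m IHm n; rewrite ltnS => nm.
have [nN|] := ltnP n N.+1.
  rewrite -ler_pdivrMr ?exprn_gt0 // /C (bigD1 (Ordinal nN)) //= lerDl.
  by apply: sumr_ge0 => j _; rewrite divr_ge0.
case: n nm => // n nm Nn.
have n1_gt0 : 0 < n.+1%:R :> R by rewrite ltr0n.
rewrite -(ler_pM2l n1_gt0) -{1}[n.+1%:R]normr_nat -normrM.
rewrite -[X in `|X|]/(pseries_diffs bell_coef n) bell_coefS normrN.
apply: le_trans (ler_norm_sum _ _ _) _.
apply: (@le_trans _ _ (\sum_(j < n.+1) C * rho ^+ n * (rho^-1 ^+ (n - j) / (n - j)`!%:R))).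
  apply: ler_sum => j _; have jn : (j <= n)%N by rewrite -ltnS.
  rewrite normrM [`|_^-1|]ger0_norm // mulrA ler_wpM2r //.
  rewrite -mulrA exprVn -[n in rho ^+ n](subnKC jn) exprD mulfK ?expf_neq0 ?gt_eqF //.
  by apply: IHm; apply: leq_trans nm.
(* Reversing the sum turns it into a partial sum of the exponential series at [rho^-1]. *)
rewrite -mulr_sumr (reindex_inj rev_ord_inj) /=.
under eq_bigr => j _ do rewrite subSS subKn -1?ltnS //.
apply: (@le_trans _ _ (C * rho ^+ n * (K * rho))).
  rewrite ler_wpM2l ?mulr_ge0 // /K divfK ?gt_eqF //.
  by rewrite exp_partial_sum_le // invr_ge0 ltW.
have -> : n.+1%:R * (C * rho ^+ n.+1) = C * rho ^+ n * (n.+1%:R * rho).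
  by rewrite exprSr; ring.
rewrite ler_wpM2l ?mulr_ge0 // ler_wpM2r ?(ltW rho_gt0) //.
by apply: le_trans (ltW KN) _; rewrite ler_nat ltnW.
Qed.

Definition bell_egf x : R := limn (pseries bell_coef x).

Lemma is_derive_bell_egf x : is_derive x (1 : R) bell_egf (- (bell_egf x * expR x)).
Proof.
suff <- : limn (pseries (pseries_diffs bell_coef) x) = - (bell_egf x * expR x).
  exact: is_derive_entire entire_bell_coef.
rewrite (_ : expR x = limn (pseries (fun n => n`!%:R^-1) x)); last first.
  by rewrite expRE.
(* The product of the two limits becomes the limit of one Cauchy product, which can be compared
   coefficientwise through [bell_coefS]. *)
have /cvg_lim <- // := @cvg_cauchy_product _ _ x entire_bell_coef entire_inv_fact.
rewrite -limN; last by apply: cvgP; exact: (cvg_cauchy_product entire_bell_coef entire_inv_fact).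
congr (limn _); apply/funext => n; rewrite /pseries /series /= -[RHS]/(- \sum_(0 <= k < n) _) -sumrN.
by apply: eq_bigr => i _; rewrite bell_coefS mulNr.
Qed.

Lemma bell_egfE x : bell_egf x = expR (1 - expR x).
Proof.
pose H := bell_egf * (expR \o expR).
have H0 y : is_derive y (1 : R) H 0.
  apply: is_derive_eq (is_deriveM (is_derive_bell_egf y)
    (is_derive1_comp (is_derive_expR _) (is_derive_expR _))) _.
  by rewrite /GRing.scale /= mulrN [expR _ * (_ * _)]mulrCA -mulrCA; ring.
have : H x = H 0 by exact: is_derive_0_is_cst.
rewrite -[H x]/(bell_egf x * expR (expR x)) -[H 0]/(bell_egf 0 * expR (expR 0)).
have -> : bell_egf 0 = 1.
  by rewrite /bell_egf limn_pseries0 /bell_coef complementary_bell0 divr1.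
rewrite mul1r expR0 expRD expRN => <-.
by rewrite mulfK // gt_eqF // expR_gt0.
Qed.

Lemma cvg_bell_egf x : pseries bell_coef x @ \oo --> expR (1 - expR x).
Proof. by rewrite -bell_egfE; exact: entire_cvg entire_bell_coef. Qed.

End PowerSeries.

Theorem theorem3p4 (R : realType) :
  (forall n : nat, (1 <= n)%N ->
     reduced_euler (multipath_complex (@transitive_tournament n)) =
     \sum_(1 <= k < n.+1) (-1 : int) ^ (n%:Z - k%:Z - 1) * (stirling2 n k)%:Z)
  /\
  has_egf
    (fun n : nat => reduced_euler (multipath_complex (@transitive_tournament n)))
    (fun x : R => - expR (1 - expR (- x))).
Proof.
split=> [n|x]; first exact: reduced_euler_tournament_stirling.
(* The sign [(-1) ^+ k] of the [k]-th value is absorbed by evaluating at [- x]. *)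
rewrite (_ : series _ = - pseries (bell_coef R) (- x)).
  by apply: cvgN; exact: cvg_bell_egf.
apply/funext => n; rewrite /pseries /series /= -[RHS]/(- \sum_(0 <= k < n) _) -sumrN.
apply: eq_bigr => k _.
rewrite reduced_euler_tournament_bell rmorphN rmorphM rmorphXn rmorphN1 /bell_coef /=.
by rewrite [in RHS]exprNn; ring.
Qed.
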